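(* Let $G^{\alpha}$ be a presentation, with finite generating set $X$, of a group $G$ and let $G_1^{\alpha_1}$ be a presentation by a Schreier basis of a subgroup $G_1$ of $G$ of finite index $|G:G_1|$. Then $$\hat\Xi(G_1^{\alpha_1})\le |G:G_1|\,\hat\Xi(G^{\alpha}).$$
   Context: Schreier basis: let $G^{\alpha}$ be a presentation of $G$ with generating set $X$ and let $T$ be a Schreier transversal for the subgroup $G_1$ of $G$ with respect to $G^{\alpha}$ (a system of representatives, given by reduced words in $X\cup X^{-1}$ closed under taking initial segments, for the cosets $G_1g$). Let $p$ be the coset map, sending an element $g$ to the representative in $T$ of $G_1g$. The Schreier basis $Y$ for $G_1$ with respect to $T$ consists of the elements $$y_{v,x}=vx\,(p(vx))^{-1},\qquad v\in T,\ x\in X,$$ that are non-trivial in $G$. The $y_{v,x}$ are not necessarily distinct elements of $G$: $Y$ is the family of generating symbols indexed by those pairs $(v,x)$ for which $y_{v,x}\ne1$ in $G$. A presentation by a Schreier basis is a presentation of $G_1$ with generating set $Y$. For a presentation $K^{\kappa}=\langle X\mid R\rangle$ of a group $K$, $X=\{x_1,\dots,x_n\}$ finite (generators are regarded as distinct symbols, although different symbols may represent the same element of $K$ and a symbol may represent the identity), the associated Cayley graph $\Gamma$ has vertex set $K$ and, for every $g\in K$ and every $j$, exactly one edge from $g$ to $gx_j$, labelled $x_j$ (loops and multiple edges are allowed). For a non-empty finite subgraph $\Gamma'$ of $\Gamma$ let $\beta_0(\Gamma')$ be its number of vertices, let $\beta_2(\Gamma')$ be its cyclomatic number, i.e. the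 sum over its connected components of the rank of the fundamental group of the component, and let $\xi(\Gamma')=\beta_2(\Gamma')/\beta_0(\Gamma')$. An exhausting chain is a sequence $\Gamma_1\subseteq\Gamma_2\subseteq\cdots$ of finite connected subgraphs of $\Gamma$ whose union is $\Gamma$. The cyclomatic quotient is $$\Xi(K^{\kappa})=\sup\limsup_{i\to\infty}\xi(\Gamma_i),$$ the supremum being over all exhausting chains; equivalently, $\Xi(K^{\kappa})=\sup\xi(\Gamma')$ over all non-empty finite subgraphs $\Gamma'$ of $\Gamma$. The normalized cyclomatic quotient is $\hat\Xi(K^{\kappa})=1-n+\Xi(K^{\kappa})$, where $n$ is the number of generating symbols. *)

(* Defs.v *)
From HB Require Import structures.
From mathcomp Require Import all_boot all_order all_algebra.
From mathcomp Require Import finmap.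
From mathcomp Require Import all_classical all_reals all_analysis.

Set Implicit Arguments.
Unset Strict Implicit.
Unset Printing Implicit Defensive.

Local Open Scope classical_set_scope.

(** A letter [(a, false)] stands for the symbol [a], and [(a, true)] for its
    formal inverse. *)
Definition letter (A : Type) : Type := (A * bool)%type.
Definition word (A : Type) : Type := seq (A * bool).

Definition letter_inv (A : Type) (l : letter A) : letter A := (l.1, ~~ l.2).
Definition word_inv (A : Type) (w : word A) : word A :=
  rev (map (@letter_inv A) w).

Definition reduced (A : eqType) (w : word A) : bool :=
  sorted (fun l m : letter A => m != letter_inv l) w.

(** Equality of words in the group [<A | rels>]. *)
Inductive word_eq (A : Type) (rels : set (word A)) : word A -> word A -> Prop :=
| word_eq_refl w : word_eq rels w w
| word_eq_sym w1 w2 : word_eq rels w1 w2 -> word_eq rels w2 w1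
| word_eq_trans w1 w2 w3 :
    word_eq rels w1 w2 -> word_eq rels w2 w3 -> word_eq rels w1 w3
| word_eq_cancel u (l : letter A) v :
    word_eq rels (u ++ [:: l; letter_inv l] ++ v) (u ++ v)
| word_eq_relator u r v : rels r -> word_eq rels (u ++ r ++ v) (u ++ v).

Definition freely_equal (A : Type) : word A -> word A -> Prop :=
  word_eq (@set0 (word A)).

(** [subst c u] replaces every symbol [i] of [u] by the word [c i]. *)
Definition subst (I A : Type) (c : I -> word A) (u : word I) : word A :=
  flatten [seq if l.2 then word_inv (c l.1) else c l.1 | l <- u].

Section Presentations.
Local Open Scope group_scope.

Definition word_val (G : groupType) (X : Type) (f : X -> G) (w : word X) : G :=
  \prod_(l <- w) (if l.2 then (f l.1)^-1 else f l.1).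

(** The map [gen] need not be injective and may take the value [1]. *)
Record presentation (G : groupType) (X : finType) := Presentation {
  gen : X -> G;
  relators : set (word X);
  gen_surj : forall g : G, exists w : word X, word_val gen w = g;
  relators_complete :
    forall w : word X, word_val gen w = 1 <-> word_eq relators w [::] }.

Definition right_coset (G : groupType) (H : {pred G}) (g : G) : set G :=
  [set h * g | h in [set h : G | h \in H]].

Definition right_cosets (G : groupType) (H : {pred G}) : set (set G) :=
  [set right_coset H g | g in [set: G]].

(** Meaningful only if [right_cosets H] is finite. *)
Definition subgroup_index (G : groupType) (H : {pred G}) : nat :=
  #|` fset_set (right_cosets H)|%fset.

Section Schreier.
Variables (G : groupType) (X : finType) (P : presentation G X).
Variables (H : {pred G}) (T : {fset word X}).

Definition schreier_transversal : Prop :=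
  [/\ forall t : word X, t \in T -> reduced t,
      forall g : G, exists! t : word X,
        t \in T /\ right_coset H (word_val (gen P) t) = right_coset H g
    & forall u v : word X, u ++ v \in T -> u \in T].

(** The coset map [p]; the default [[::]] is never used when [T] is a
    transversal. *)
Definition coset_rep (g : G) : word X :=
  if [pick t : T | right_coset H (word_val (gen P) (val t))
                     == right_coset H g] is Some t
  then val t else [::].

Definition schreier_elt (vx : T * X) : G :=
  let g := word_val (gen P) (val vx.1) * gen P vx.2 in
  g * (word_val (gen P) (coset_rep g))^-1.

(** Distinct pairs are distinct symbols, even when they have the same value. *)
Definition schreier_basis : finType :=
  {vx : T * X | schreier_elt vx != 1}.

Definition is_schreier_presentation (G1 : subGroupType H)
    (P1 : presentation G1 schreier_basis) : Prop :=
  forall y : schreier_basis, val (gen P1 y) = schreier_elt (val y).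

End Schreier.
End Presentations.

(** Multigraphs: loops and multiple edges are allowed.  The direction of an
    edge only serves to name its two ends. *)
Record multigraph := Multigraph {
  vertex : choiceType;
  edge : choiceType;
  src : edge -> vertex;
  tgt : edge -> vertex }.

Record subgraph (Gam : multigraph) := Subgraph {
  verts : {fset vertex Gam};
  edges : {fset edge Gam};
  src_verts : forall e : edge Gam, e \in edges -> src e \in verts;
  tgt_verts : forall e : edge Gam, e \in edges -> tgt e \in verts }.

Section Graphs.
Variable Gam : multigraph.
Implicit Types (S : subgraph Gam) (u v : vertex Gam).

Definition linked S : rel (verts S) := fun u v : verts S =>
  [exists e : edges S, ((src (val e) == val u) && (tgt (val e) == val v))
                    || ((src (val e) == val v) && (tgt (val e) == val u))].

Definition connected_subgraph S : Prop :=
  verts S != fset0 /\ forall u v : verts S, connect (@linked S) u v.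

(** An edge path is a word in the edges; the letter [(e, true)] traverses [e]
    from its target to its source. *)
Definition letter_src (l : letter (edge Gam)) : vertex Gam :=
  if l.2 then tgt l.1 else src l.1.
Definition letter_tgt (l : letter (edge Gam)) : vertex Gam :=
  if l.2 then src l.1 else tgt l.1.

Fixpoint is_path S u (w : word (edge Gam)) v : bool :=
  if w is l :: w' then
    [&& l.1 \in edges S, letter_src l == u & is_path S (letter_tgt l) w' v]
  else u == v.

(** The fundamental group of [S] at [v] consists of the closed edge paths of [S]
    at [v] up to free equality.  The free reduction of a path of [S] is a
    path of [S], so it does not matter that [freely_equal] may pass through
    words that are not. *)
Definition pi1_generated S v (k : nat) : Prop :=
  exists c : 'I_k -> word (edge Gam),
    (forall i : 'I_k, is_path S v (c i) v) /\
    (forall w : word (edge Gam), is_path S v w v ->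
       exists u : word 'I_k, freely_equal w (subst c u)).

(** The rank of a group is the least number of elements generating it; here it
    exists because [S] is finite. *)
Definition pi1_rank S v : nat :=
  xget 0 [set k : nat | pi1_generated S v k /\
                        forall m : nat, pi1_generated S v m -> k <= m].

(** [roots] selects one base point in each connected component. *)
Definition cyclomatic_number S : nat :=
  \sum_(v : verts S | v \in roots (@linked S)) pi1_rank S (val v).

Definition exhausting_chain (S : nat -> subgraph Gam) : Prop :=
  [/\ forall i : nat, connected_subgraph (S i),
      forall i : nat, (verts (S i) `<=` verts (S i.+1))%fset,
      forall i : nat, (edges (S i) `<=` edges (S i.+1))%fset,
      forall v : vertex Gam, exists i : nat, v \in verts (S i)
    & forall e : edge Gam, exists i : nat, e \in edges (S i)].

Variable R : realType.
Local Open Scope ring_scope.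

Definition xi S : R := (cyclomatic_number S)%:R / #|` verts S|%fset%:R.

Definition cyclomatic_quotient : \bar R :=
  ereal_sup [set limn_esup (fun i : nat => (xi (S i))%:E)
            | S in exhausting_chain].

End Graphs.

Definition cayley (K : groupType) (X : finType) (P : presentation K X) :
    multigraph :=
  @Multigraph K (K * X)%type (fun e => e.1) (fun e => (e.1 * gen P e.2)%g).

Definition normalized_cyclomatic_quotient (R : realType) (K : groupType)
    (X : finType) (P : presentation K X) : \bar R :=
  ((1 - #|X|%:R)%:E + cyclomatic_quotient (cayley P) R)%E.

(* Main.v *)
Require Import Defs.
From mathcomp Require Import all_boot all_order all_algebra.
From mathcomp Require Import finmap ring.
From mathcomp Require Import all_classical all_reals all_analysis.

(** Let [m] be the index of [G1], [n] the number of generators of [G], and [b]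
    the number of symbols of the Schreier basis.  As [T] is a transversal, every
    element of [G] is [a t] for exactly one pair [(a, t)] in [G1 * T], and the
    edges of the Cayley graph of [G] are indexed by the triples [(a, t, x)].
    Since [t x = y_(t,x) p(t x)], the edge [(a, t, x)] leads from the point
    [a t] to the point [(a y_(t,x)) p(t x)].  So the Cayley graph of [G] is
    obtained from that of [G1] by replacing each vertex [a] by the points [a t],
    joined by the edges [(a, t, x)] with [y_(t,x) = 1], and each edge
    [(a, y_(t,x))] by the edge [(a, t, x)].  Because [T] is closed under initial
    segments, the edges with trivial [y_(t,x)] contain a tree joining all the
    points over [a].

    Carrying out this replacement on a finite connected subgraph [S] of the
    Cayley graph of [G1] gives a finite connected subgraph [S'] of that of [G]
    with [m] times as many vertices and with [m * n - b] additional edges for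
    each vertex of [S].  The cyclomatic number of a connected finite graph is
    one plus the number of edges minus the number of vertices
    ([cyclomatic_number_connected]), whence the exact relation
    [1 - b + xi S = m * (1 - n + xi S')] ([xi_lift]).  The construction maps
    exhausting chains to exhausting chains ([lift_exhausting_chain]), so passing
    to upper limits and suprema yields the inequality.

    The formula for the cyclomatic number is proved with a spanning tree: the
    closed paths that run through a single edge outside the tree generate the
    fundamental group, and no smaller family does, because the signed numbers
    of passages through the edges outside the tree are additive and invariant
    under free reduction, and on those closed paths they form an identity
    matrix. *)

Set Implicit Arguments.
Unset Strict Implicit.
Unset Printing Implicit Defensive.

Import Order.TTheory GRing.Theory Num.Theory.

(** * Words and free equality *)

Section Words.
Variable A : Type.
Implicit Types (l : letter A) (u v w : word A) (rels : set (word A)).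

Lemma letter_invK : involutive (@letter_inv A).
Proof. by case=> a b; rewrite /letter_inv /= negbK. Qed.

Lemma word_inv_cat u v : word_inv (u ++ v) = word_inv v ++ word_inv u.
Proof. by rewrite /word_inv map_cat rev_cat. Qed.

Lemma word_invK : involutive (@word_inv A).
Proof.
move=> w; rewrite /word_inv map_rev revK -map_comp.
by rewrite (eq_map letter_invK) map_id.
Qed.

Lemma word_eq_cat2 rels a b u v :
  word_eq rels u v -> word_eq rels (a ++ u ++ b) (a ++ v ++ b).
Proof.
elim=> {u v} [w|u v _|u v w _ IHu _|u l v|u r v rr].
- exact: word_eq_refl.
- exact: word_eq_sym.
- exact: word_eq_trans.
- by have := word_eq_cancel rels (a ++ u) l (v ++ b); rewrite !catA.
- by have := word_eq_relator (a ++ u) (v ++ b) rr; rewrite !catA.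
Qed.

Lemma word_eq_cat rels u u' v v' :
  word_eq rels u u' -> word_eq rels v v' -> word_eq rels (u ++ v) (u' ++ v').
Proof.
move=> uu' vv'; apply: (word_eq_trans (w2 := u' ++ v)).
  exact: (word_eq_cat2 [::] v uu').
by have := word_eq_cat2 u' [::] vv'; rewrite !cats0.
Qed.

Lemma word_eq_catV rels w : word_eq rels (w ++ word_inv w) [::].
Proof.
elim: w => [|l w IHw]; first exact: word_eq_refl.
rewrite -cat1s word_inv_cat.
have /= := word_eq_cat2 [:: l] (word_inv [:: l]) IHw.
rewrite -!catA => /word_eq_trans; apply.
exact: (word_eq_cancel rels [::] l [::]).
Qed.

Lemma word_eq_Vcat rels w : word_eq rels (word_inv w ++ w) [::].
Proof. by rewrite -{2}[w]word_invK; exact: word_eq_catV. Qed.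

Lemma subst_cat (I : Type) (c : I -> word A) (s t : word I) :
  subst c (s ++ t) = subst c s ++ subst c t.
Proof. by rewrite /subst map_cat flatten_cat. Qed.

End Words.

Section SignedCount.
Local Open Scope ring_scope.

(** The number of occurrences of the symbol [a] in [w], those of its inverse
    counting negatively. *)
Definition signed_count (A : eqType) (w : word A) (a : A) : rat :=
  \sum_(l <- w) (-1) ^+ l.2 * (l.1 == a)%:R.

Lemma signed_count_cat (A : eqType) (u v : word A) a :
  signed_count (u ++ v) a = signed_count u a + signed_count v a.
Proof. exact: big_cat. Qed.

Lemma signed_count_inv (A : eqType) (w : word A) a :
  signed_count (word_inv w) a = - signed_count w a.
Proof.
rewrite /signed_count /word_inv (perm_big _ (permEl (perm_rev _))) big_map.
rewrite -sumrN.
by apply: eq_bigr => -[b s] _ /=; rewrite signrN mulNr.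
Qed.

Lemma signed_count_freely_equal (A : eqType) (u v : word A) a :
  freely_equal u v -> signed_count u a = signed_count v a.
Proof.
elim=> {u v} // [u v w _ -> //|u l v].
rewrite !signed_count_cat /signed_count !big_cons big_nil /= signrN mulNr addr0.
by rewrite subrr add0r.
Qed.

Lemma signed_count_subst (I : finType) (A : eqType) (c : I -> word A) s a :
  signed_count (subst c s) a =
  \sum_i signed_count s i * signed_count (c i) a.
Proof.
elim: s => [|[j b] s IHs].
  by rewrite /signed_count big_nil big1 // => i _; rewrite big_nil mul0r.
rewrite -cat1s subst_cat signed_count_cat IHs.
under [RHS]eq_bigr do rewrite signed_count_cat mulrDl.
rewrite big_split /=; congr (_ + _).
rewrite (bigD1 j) //= big1 => [|i ij].
  rewrite /signed_count big_seq1 /= eqxx mulr1 addr0 -!/(signed_count _ _).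
  rewrite /subst /= cats0.
  by case: b; rewrite ?signed_count_inv /= ?mulN1r ?mul1r.
by rewrite {1}/signed_count big_seq1 /= eq_sym (negbTE ij) mulr0 mul0r.
Qed.

Lemma signed_count_notin (A : eqType) (w : word A) a :
  (forall l, l \in w -> l.1 != a) -> signed_count w a = 0.
Proof.
move=> wa; rewrite /signed_count big_seq big1 // => l /wa /negbTE ->.
by rewrite mulr0.
Qed.

End SignedCount.

(** * The fundamental group of a connected finite graph *)

Section Graph.
Variable Gam : multigraph.
Implicit Types (S : subgraph Gam) (l : letter (edge Gam)) (w : word (edge Gam)).
Implicit Types (F : {fset edge Gam}) (U : {fset vertex Gam}).
Implicit Types (q : vertex Gam -> word (edge Gam)).

Lemma letter_src_inv l : letter_src (letter_inv l) = letter_tgt l.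
Proof. by case: l => e []. Qed.

Lemma letter_tgt_inv l : letter_tgt (letter_inv l) = letter_src l.
Proof. by case: l => e []. Qed.

Lemma letter_src_verts S l : l.1 \in edges S -> letter_src l \in verts S.
Proof. by case: l => e [] /=; [exact: tgt_verts | exact: src_verts]. Qed.

Lemma letter_tgt_verts S l : l.1 \in edges S -> letter_tgt l \in verts S.
Proof. by rewrite -letter_src_inv => lS; apply: letter_src_verts. Qed.

Lemma is_path_cat S u v x w1 w2 :
  is_path S u w1 v -> is_path S v w2 x -> is_path S u (w1 ++ w2) x.
Proof.
elim: w1 u => [u /eqP -> //|l w1 IHw1 u /= /and3P[-> ->]].
exact: IHw1.
Qed.

Lemma is_path_inv S u v w : is_path S u w v -> is_path S v (word_inv w) u.
Proof.
elim: w u => [u /eqP -> /=|l w IHw u /= /and3P[lS /eqP lu /IHw p]]; first by [].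
rewrite -cat1s word_inv_cat; apply: is_path_cat p _ => /=.
by rewrite lS letter_src_inv letter_tgt_inv lu !eqxx.
Qed.

Lemma linked_sym S : connect_sym (@linked Gam S).
Proof.
by apply: sym_connect_sym => u v; apply: eq_existsb => e; rewrite orbC.
Qed.

(** Connectedness as an induction principle: a property that is invariant
    along edges and holds somewhere holds everywhere. *)
Lemma connected_ind S (Q : vertex Gam -> Prop) :
    connected_subgraph S ->
    (forall e, e \in edges S -> Q (src e) <-> Q (tgt e)) ->
  forall u, u \in verts S -> Q u -> forall v, v \in verts S -> Q v.
Proof.
move=> [_ connS] Qe u uS Qu v vS.
suff step (x y : verts S) :
    connect (@linked Gam S) x y -> Q (val x) -> Q (val y).
  exact: (step [` uS]%fset [` vS]%fset (connS _ _) Qu).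
move=> /connectP[p + ->]; elim: p x => //= z p IHp x.
move=> /andP[/existsP[e /orP[]/andP[/eqP ex /eqP ez]] zp] Qx; apply: IHp zp _.
  by rewrite -ez -Qe ?ex // (valP e).
by rewrite -ex Qe ?ez // (valP e).
Qed.

(** The converse of [connected_ind]. *)
Lemma connected_intro S : verts S != fset0 ->
    (forall Q : vertex Gam -> Prop,
       (forall e, e \in edges S -> Q (src e) <-> Q (tgt e)) ->
       forall u v, u \in verts S -> v \in verts S -> Q u -> Q v) ->
  connected_subgraph S.
Proof.
move=> S0 indS; split=> // u v.
pose Q x := exists2 y : verts S, val y = x & connect (@linked Gam S) u y.
have Qe e : e \in edges S -> Q (src e) <-> Q (tgt e).
  move=> eS; have [sS tS] := (src_verts eS, tgt_verts eS).
  have st : linked [` sS]%fset [` tS]%fset.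
    by apply/existsP; exists [` eS]%fset; rewrite /= !eqxx.
  split=> -[y yE uy].
    exists [` tS]%fset => //; apply: connect_trans uy _.
    by rewrite (_ : y = [` sS]%fset) ?connect1 //; exact: val_inj.
  exists [` sS]%fset => //; apply: connect_trans uy _.
  by rewrite linked_sym (_ : y = [` tS]%fset) ?connect1 //; exact: val_inj.
have [|y /val_inj <- //] := indS Q Qe (val u) (val v) (valP u) (valP v).
by exists u.
Qed.


(** A tree rooted at [v], with vertices [U] and edges [F], inside [S]; [q u] is
    the path of the tree from [v] to [u], and up to free equality it changes
    along an edge of the tree by that edge only. *)
Definition rooted_tree S v U F q : Prop :=
  [/\ q v = [::],
      forall u, u \in U -> is_path S v (q u) u,
      forall u, u \in U -> {in q u, forall l, l.1 \in F},
      forall e, e \in F -> [/\ src e \in U, tgt e \in U &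
        freely_equal (q (src e) ++ [:: (e, false)]) (q (tgt e))]
    & #|` F|%fset.+1 = #|` U|%fset].

(** A rooted tree grows by any edge that leaves its set of vertices, in either
    direction of traversal. *)
Lemma rooted_tree_extend S v U F q l :
    rooted_tree S v U F q -> v \in U -> l.1 \in edges S ->
    letter_src l \in U -> letter_tgt l \notin U ->
  rooted_tree S v (letter_tgt l |` U)%fset (l.1 |` F)%fset
    (fun u => if u == letter_tgt l then rcons (q (letter_src l)) l else q u).
Proof.
move=> [qv qpath qF Fq cardF] vU lS srcU tgtU.
have neqU u : u \in U -> (u == letter_tgt l) = false.
  by move=> uU; apply: contraNF tgtU => /eqP <-.
have lF : l.1 \notin F.
  by apply: contraNN tgtU => /Fq[sU tU _]; rewrite /letter_tgt; case: ifP.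
split=> [|u|u|e|].
- by rewrite neqU.
- rewrite in_fset1U; case: eqP => [-> _|_ /= /qpath//].
  rewrite -cats1; apply: is_path_cat (qpath _ srcU) _.
  by rewrite /= lS !eqxx.
- rewrite in_fset1U; case: eqP => [_ _|_ /= uU] k.
    rewrite mem_rcons inE => /predU1P[->|/(qF _ srcU) kF]; first exact: fset1U1.
    exact: fset1Ur.
  by move=> /(qF _ uU); exact: fset1Ur.
- rewrite in_fset1U => /predU1P[->|eF].
    move: srcU tgtU lS neqU {lF}; case: l => e' [] /= srcU tgtU lS neqU.
      rewrite /letter_src /letter_tgt /= in srcU tgtU neqU *.
      rewrite fset1U1 fset1Ur // eqxx neqU //; split=> //.
      rewrite -cats1 -catA -[X in freely_equal _ X]cats0.
      exact: (word_eq_cancel _ _ (e', true) [::]).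
    rewrite /letter_src /letter_tgt /= in srcU tgtU neqU *.
    rewrite fset1U1 fset1Ur // eqxx neqU // cats1; split=> //.
    exact: word_eq_refl.
  have [sU tU eq] := Fq e eF.
  by rewrite !fset1Ur // !neqU.
- by rewrite !cardfsU1 lF tgtU !add1n cardF.
Qed.

Lemma spanning_tree S v : connected_subgraph S -> v \in verts S ->
  exists F q, (F `<=` edges S)%fset /\ rooted_tree S v (verts S) F q.
Proof.
move=> connS vS.
have [U [F [q []]]] : exists U F q, [/\ v \in U, (U `<=` verts S)%fset,
    (F `<=` edges S)%fset & rooted_tree S v U F q].
  exists [fset v]%fset, fset0, (fun=> [::]); split; rewrite ?fset11 ?fsub1set //.
  by split=> // [u|]; rewrite ?cardfs1 ?cardfs0 // inE => /eqP ->; rewrite /= eqxx.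
(* The tree grows until no edge of [S] leaves its set of vertices, which is
   then all of [verts S] by connectedness. *)
have [n] := ubnP #|` verts S `\` U|%fset; elim: n U F q => // n IHn U F q.
rewrite ltnS => leUn vU US FS tree.
have [allU|] := pselect (forall l, l.1 \in edges S -> letter_src l \in U ->
    letter_tgt l \in U).
  exists F, q; split=> //; suff <- : U = verts S by [].
  apply/eqP; rewrite eqEfsubset US; apply/fsubsetP.
  apply: (connected_ind connS _ vS vU) => e eS.
  by split; [exact: (allU (e, false)) | exact: (allU (e, true))].
move=> /existsNP[l /not_implyP[lS /not_implyP[srcU /negP tgtU]]].
apply: IHn (rooted_tree_extend tree vU lS srcU tgtU).
- apply: leq_trans leUn; apply: fproper_ltn_card.
  have -> : (verts S `\` (letter_tgt l |` U) =
             verts S `\` U `\ letter_tgt l)%fset.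
    by apply/fsetP => u; rewrite in_fsetD1 !in_fsetD in_fset1U negb_or andbA.
  by apply: fproperD1; rewrite in_fsetD tgtU letter_tgt_verts.
- exact: fset1Ur.
- by rewrite fsubUset US fsub1set letter_tgt_verts.
- by rewrite fsubUset FS fsub1set lS.
Qed.

Section Rank.
Variables (S : subgraph Gam) (v : vertex Gam) (F : {fset edge Gam}).
Variable q : vertex Gam -> word (edge Gam).
Hypothesis tree : rooted_tree S v (verts S) F q.

(** The closed path that runs in the tree from [v] to the source of [e], then
    through [e], and back to [v] in the tree. *)
Let loop (e : edge Gam) : word (edge Gam) :=
  q (src e) ++ (e, false) :: word_inv (q (tgt e)).

(** The edges of [S] outside the tree. *)
Let chords : {fset edge Gam} := (edges S `\` F)%fset.

Let loop_path e : e \in edges S -> is_path S v (loop e) v.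
Proof.
case: tree => _ qpath _ _ _ eS; apply: is_path_cat (qpath _ (src_verts eS)) _.
by rewrite /= eS eqxx /=; apply: is_path_inv; apply: qpath; apply: tgt_verts.
Qed.

Let loop_letter l : l.1 \in edges S ->
  freely_equal (q (letter_src l) ++ l :: word_inv (q (letter_tgt l)))
    (if l.2 then word_inv (loop l.1) else loop l.1).
Proof.
case: l => e [] _; last exact: word_eq_refl.
rewrite /= /loop -[(e, false) :: _]cat1s !word_inv_cat word_invK -catA.
exact: word_eq_refl.
Qed.

Let loop_tree e : e \in F -> freely_equal (loop e) [::].
Proof.
case: tree => _ _ _ Fq _ /Fq[_ _ eF].
rewrite /loop -cat1s catA.
apply: word_eq_trans (word_eq_catV _ (q (tgt e))).
exact: word_eq_cat eF (word_eq_refl _ _).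
Qed.

(** Closing up a path of [S] with paths of the tree at both ends turns it into
    a product of the loops of the chords, one factor for each passage through
    a chord. *)
Let path_subst u w x : is_path S u w x ->
  exists s : word chords,
    freely_equal (q u ++ w ++ word_inv (q x)) (subst (loop \o val) s).
Proof.
elim: w u => [u /eqP ->|l w IHw u].
  by exists [::]; exact: word_eq_catV.
move=> /and3P[lS /eqP <- /IHw[s ws]].
have [t lt] : exists t : word chords,
    freely_equal (q (letter_src l) ++ l :: word_inv (q (letter_tgt l)))
      (subst (loop \o val) t).
  have [lF|lF] := boolP (l.1 \in F).
    exists [::]; apply: word_eq_trans (loop_letter lS) _.
    case: ifP => _; last exact: loop_tree.
    have := word_eq_cat2 (word_inv (loop l.1)) [::] (loop_tree lF).
    rewrite !cats0 => /word_eq_sym /word_eq_trans; apply.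
    exact: word_eq_Vcat.
  have lC : l.1 \in chords by rewrite in_fsetD lF lS.
  exists [:: ([` lC]%fset, l.2)]; rewrite /subst /= cats0.
  exact: loop_letter.
exists (t ++ s); rewrite subst_cat.
apply: word_eq_trans (word_eq_cat lt ws).
apply: word_eq_sym; have := word_eq_cat2 (q (letter_src l) ++ [:: l])
  (w ++ word_inv (q x)) (word_eq_Vcat set0 (q (letter_tgt l))).
by rewrite -!catA.
Qed.

Lemma pi1_generated_chords : pi1_generated S v #|` chords|%fset.
Proof.
case: (tree) => qv _ _ _ _.
rewrite cardfE; exists (loop \o val \o enum_val); split=> [i|w].
  by apply: loop_path; case/fsetDP: (valP (enum_val i)).
move=> /path_subst[s]; rewrite qv /= cats0 => ws.
exists [seq (enum_rank l.1, l.2) | l : letter chords <- s].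
suff -> : subst (loop \o val \o enum_val)
    [seq (enum_rank l.1, l.2) | l : letter chords <- s] = subst (loop \o val) s by [].
rewrite /subst -map_comp; congr flatten; apply: eq_map => l /=.
by rewrite enum_rankK.
Qed.

Lemma leq_chords_pi1_generated m :
  pi1_generated S v m -> #|` chords|%fset <= m.
Proof.
case: tree => _ _ qF _ _ [c [_ genc]].
have /choice[s sE] : forall e : chords,
    exists s : word 'I_m, freely_equal (loop (val e)) (subst c s).
  by move=> e; apply/genc/loop_path; case/fsetDP: (valP e).
(* The loop of [e] passes once through [e] and through no other chord. *)
have loopE (e a : chords) :
    signed_count (loop (val e)) (val a) = (e == a)%:R%R.
  have q0 u : u \in verts S -> signed_count (q u) (val a) = 0%R.
    move=> uS; apply: signed_count_notin => l /(qF _ uS) lF.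
    by apply: contraTneq lF => ->; case/fsetDP: (valP a).
  have /fsetDP[eS _] := valP e.
  rewrite /loop -cat1s !signed_count_cat signed_count_inv.
  rewrite !q0 ?src_verts ?tgt_verts //.
  by rewrite subr0 add0r /signed_count big_seq1 /= mul1r val_eqE.
(* The identity matrix, indexed by the chords, factors through dimension [m]. *)
pose A : 'M[rat]_(#|{: chords}|, m) :=
  (\matrix_(i, j) signed_count (s (enum_val i)) j)%R.
pose B : 'M[rat]_(m, #|{: chords}|) :=
  (\matrix_(j, i) signed_count (c j) (val (enum_val i)))%R.
rewrite cardfE; apply: (@mulmx1_min _ _ _ A B); apply/matrixP => i k.
rewrite !mxE -[RHS]/((i == k)%:R)%R -(inj_eq enum_val_inj) -loopE.
rewrite (signed_count_freely_equal _ (sE _)) signed_count_subst.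
by apply: eq_bigr => j _; rewrite !mxE.
Qed.

End Rank.

(** The Euler characteristic formula for the rank of the fundamental group. *)
Lemma pi1_rank_connected S v : connected_subgraph S -> v \in verts S ->
  pi1_rank S v + #|` verts S|%fset = #|` edges S|%fset + 1.
Proof.
move=> connS vS; have [F [q [FS tree]]] := spanning_tree connS vS.
have <- : #|` edges S `\` F|%fset = pi1_rank S v.
  apply/esym/xget_unique; first split.
  - exact: pi1_generated_chords tree.
  - by move=> m; apply: leq_chords_pi1_generated; exact: tree.
  move=> k [genk mink]; apply/eqP; rewrite eqn_leq; apply/andP; split.
    by apply: mink; exact: pi1_generated_chords tree.
  by apply: leq_chords_pi1_generated genk; exact: tree.
case: tree => _ _ _ _ <-; rewrite addn1 addnS; congr _.+1.
by rewrite cardfsDS // subnK // fsubset_leq_card.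
Qed.

(** A connected graph has a single component, so only one base point counts. *)
Lemma cyclomatic_number_connected S : connected_subgraph S ->
  cyclomatic_number S + #|` verts S|%fset = #|` edges S|%fset + 1.
Proof.
move=> connS; have [/fset0Pn[v0 v0S] conn] := connS.
pose r := fingraph.root (@linked Gam S) [` v0S]%fset.
rewrite -(pi1_rank_connected connS (valP r)) /cyclomatic_number.
rewrite (big_pred1 r) // => u.
have rE : fingraph.root (@linked Gam S) u = r.
  by apply/eqP; rewrite root_connect //; exact: linked_sym.
by rewrite -[LHS]/(fingraph.root (@linked Gam S) u == u) rE eq_sym.
Qed.

End Graph.

(** * Cosets and the Schreier transversal *)

Lemma cardfsM (K K' : choiceType) (A : {fset K}) (B : {fset K'}) :
  #|` (A `*` B)|%fset = (#|` A|%fset * #|` B|%fset)%N.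
Proof.
rewrite /fsetM (perm_size (enum_imfset2 _ _)) ?size_allpairs //.
by move=> [a b] [a' b'] _ _ /= [-> ->].
Qed.

Section SchreierLift.
Local Open Scope group_scope.

Variables (G : groupType) (X : finType) (P : presentation G X).
Variables (H : {pred G}) (G1 : subGroupType H) (T : {fset word X}).
Hypothesis schreierT : schreier_transversal P H T.

Local Notation wval := (word_val (gen P)).
Local Notation rep := (coset_rep P H T).
Local Notation elt := (@schreier_elt G X P H T).

Lemma right_cosetP g g' :
  right_coset H g = right_coset H g' <-> exists a : G1, g = val a * g'.
Proof.
split=> [eqH|[a ->]].
  have : right_coset H g' g 
    by rewrite -eqH; exists 1; rewrite ?mul1g //= -(monoid.val1 G1); exact: valP.
  by case=> h hH <-; exists (Sub h hH); rewrite SubK.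
rewrite /right_coset; apply/seteqP; split=> _ [h /= hH <-].
  exists (h * val a); last by rewrite mulgA.
  by rewrite -(SubK G1 hH) -monoid.valM /=; exact: valP.
exists (h * (val a)^-1); last by rewrite -mulgA mulKg.
by rewrite -(SubK G1 hH) -gmulfV -monoid.valM /=; exact: valP.
Qed.

Lemma coset_rep_in g : rep g \in T.
Proof.
rewrite /coset_rep; case: pickP => [t _|none]; first exact: valP.
have [_ /(_ g)[t [[tT eqt] _]] _] := schreierT.
by have := none [` tT]%fset; rewrite eqt eqxx.
Qed.

Lemma coset_repE g : right_coset H (wval (rep g)) = right_coset H g.
Proof.
rewrite /coset_rep; case: pickP => [t /eqP //|none].
have [_ /(_ g)[t [[tT eqt] _]] _] := schreierT.
by have := none [` tT]%fset; rewrite eqt eqxx.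
Qed.

Lemma coset_rep_unique t g :
  t \in T -> right_coset H (wval t) = right_coset H g -> rep g = t.
Proof.
move=> tT tg; have [_ /(_ g)[s [_ uniq]] _] := schreierT.
rewrite -(uniq t) // -(uniq (rep g)) //.
by split; [exact: coset_rep_in | exact: coset_repE].
Qed.

Lemma coset_rep_mul (a : G1) t : t \in T -> rep (val a * wval t) = t.
Proof.
move=> tT; apply: coset_rep_unique => //; apply/esym/right_cosetP.
by exists a.
Qed.

Lemma coset_rep_wval t : t \in T -> rep (wval t) = t.
Proof. by move=> tT; apply: coset_rep_unique. Qed.

Lemma nil_in_transversal : [::] \in T.
Proof.
have [_ _ prefT] := schreierT.
exact: (prefT [::] (rep 1) (coset_rep_in 1)).
Qed.

(** The element [a t] of [G] with coordinates [(a, t)]. *)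
Definition coset_point (at_ : G1 * T) : G := val at_.1 * wval (val at_.2).

(** [coset_rep] recovers [t] from [a t]. *)
Lemma coset_point_inj : injective coset_point.
Proof.
move=> [a t] [b s]; rewrite /coset_point /= => eq.
have ts : t = s.
  apply: val_inj; rewrite -[val t](coset_rep_mul a (valP t)) eq.
  by rewrite coset_rep_mul //; exact: valP.
by move: eq; rewrite ts => /mulIg /val_inj ->.
Qed.

Lemma coset_point_surj g : exists at_, coset_point at_ = g.
Proof.
have /esym/right_cosetP[a eq] := coset_repE g.
by exists (a, [` coset_rep_in g]%fset).
Qed.

Lemma subgroup_index_transversal : subgroup_index H = #|` T|%fset.
Proof.
have cosetsE : right_cosets H =
    [set right_coset H (wval t) | t in [set` T]]%classic.
  apply/seteqP; split=> [_ [g _ <-]|_ [t _ <-]]; last by exists (wval t).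
  by exists (rep g); [exact: coset_rep_in | exact: coset_repE].
rewrite /subgroup_index cosetsE fset_set_image // set_fsetK.
rewrite card_in_imfset //= => s t sT tT eq.
by rewrite -(coset_rep_wval sT); apply: coset_rep_unique.
Qed.

Lemma schreier_elt_mul (t : T) x :
  wval (val t) * gen P x = elt (t, x) * wval (rep (wval (val t) * gen P x)).
Proof. by rewrite /schreier_elt /= mulgVK. Qed.


(** * Lifting subgraphs of the Cayley graph of the subgroup *)

Variable P1 : presentation G1 (schreier_basis P H T).
Hypothesis schreierP1 : is_schreier_presentation P1.

Implicit Types (S : subgraph (cayley P1)).

(** The edges of the Cayley graph of [G] are indexed by triples [(a, (t, x))],
    since [coset_point] is a bijection. *)
Definition coset_edge (e : G1 * (T * X)) : G * X :=
  (coset_point (e.1, e.2.1), e.2.2).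

Lemma coset_edge_inj : injective coset_edge.
Proof.
by move=> [a [t x]] [b [s y]] [eq ->]; have [-> ->] := coset_point_inj eq.
Qed.

(** The pairs [(t, x)] with [y_(t,x) = 1], which give no symbol of the Schreier
    basis. *)
Definition trivial_symbols : {fset T * X} :=
  [fset tx in [pred tx | elt tx == 1]]%fset.

Lemma mem_trivial_symbols tx : (tx \in trivial_symbols) = (elt tx == 1).
Proof. by rewrite !inE. Qed.

Lemma card_trivial_symbols :
  (#|` trivial_symbols|%fset + #|schreier_basis P H T| = #|` T|%fset * #|X|)%N.
Proof.
rewrite card_imfset //= -cardE card_sig cardfE -card_prod.
rewrite -(cardC [pred tx | elt tx == 1]).
by congr (_ + _)%N; apply: eq_card.
Qed.

(** The indices of the edges lying over [S]: those coming from an edge of [S],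
    and those with trivial symbol over each vertex of [S]. *)
Definition lift_indices S : {fset G1 * (T * X)} :=
  ([fset (e.1, val e.2) | e in edges S] `|` verts S `*` trivial_symbols)%fset.

Lemma lift_indicesP S a (tx : T * X) :
  (a, tx) \in lift_indices S <->
  (exists2 y, val y = tx & (a, y) \in edges S) \/ (a \in verts S /\ elt tx = 1).
Proof.
rewrite /lift_indices in_fsetU in_fsetM mem_trivial_symbols; split.
  case/orP=> [/imfsetP[[b y] /= eS [-> ->]]|/andP[aS /eqP]]; last by right.
  by left; exists y.
case=> [[y <- eS]|[aS ->]]; last by rewrite aS eqxx orbT.
by apply/orP; left; apply/imfsetP; exists (a, y).
Qed.

Definition lift_verts S : {fset G} :=
  [fset coset_point at_ | at_ in verts S `*` [fset t : T in predT]]%fset.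

Definition lift_edges S : {fset G * X} :=
  [fset coset_edge e | e in lift_indices S]%fset.

Lemma lift_vertsP S g :
  g \in lift_verts S <-> exists a t, a \in verts S /\ g = coset_point (a, t).
Proof.
split=> [/imfsetP[[a t] /=]|[a [t [aS ->]]]].
  by rewrite in_fsetM => /andP[/= aS _] ->; exists a, t.
by apply/imfsetP; exists (a, t) => //=; rewrite in_fsetM /= aS inE.
Qed.

Lemma mem_coset_edge S e :
  coset_edge e \in lift_edges S = (e \in lift_indices S).
Proof. by rewrite /lift_edges mem_imfset //; exact: coset_edge_inj. Qed.

Lemma mem_coset_point S at_ :
  coset_point at_ \in lift_verts S = (at_.1 \in verts S).
Proof.
rewrite /lift_verts mem_imfset /=; last exact: coset_point_inj.
by rewrite in_fsetM inE andbT.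
Qed.

Lemma coset_edge_src e :
  src (m := cayley P) (coset_edge e) = coset_point (e.1, e.2.1).
Proof. by []. Qed.

(** The lift of an edge of the Cayley graph of [G1] ends over the end of that
    edge. *)
Lemma coset_edge_tgt_basis a (y : schreier_basis P H T) :
  tgt (m := cayley P) (coset_edge (a, val y)) =
  coset_point (a * gen P1 y,
    [` coset_rep_in (wval (val (val y).1) * gen P (val y).2)]%fset).
Proof.
case: y => -[t x] e1 /=; rewrite /coset_point /= monoid.valM schreierP1 /=.
by rewrite -!mulgA mulVg mulg1.
Qed.

(** An edge with trivial symbol stays over the same vertex. *)
Lemma coset_edge_tgt_trivial a (t : T) x : elt (t, x) = 1 ->
  tgt (m := cayley P) (coset_edge (a, (t, x))) =
  coset_point (a, [` coset_rep_in (wval (val t) * gen P x)]%fset).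
Proof.
move=> e1; rewrite /= /coset_point /= -mulgA.
by rewrite [in LHS]schreier_elt_mul e1 mul1g.
Qed.

Lemma lift_src_verts S (e : edge (cayley P)) :
  e \in lift_edges S -> src e \in lift_verts S.
Proof.
case/imfsetP=> -[a tx] /= /lift_indicesP aS ->; rewrite mem_coset_point /=.
by case: aS => [[y _ /src_verts]|[]].
Qed.

Lemma lift_tgt_verts S (e : edge (cayley P)) :
  e \in lift_edges S -> tgt e \in lift_verts S.
Proof.
case/imfsetP=> -[a tx] /lift_indicesP aS ->.
case: aS => [[y <- /tgt_verts eS]|[]].
  by rewrite coset_edge_tgt_basis mem_coset_point.
case: tx => t x aS e1.
by rewrite coset_edge_tgt_trivial // mem_coset_point.
Qed.

(** The subgraph of the Cayley graph of [G] lying over [S]. *)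
Definition lift_subgraph S : subgraph (cayley P) :=
  @Subgraph (cayley P) (lift_verts S) (lift_edges S)
    (@lift_src_verts S) (@lift_tgt_verts S).

Lemma card_lift_verts S :
  #|` verts (lift_subgraph S)|%fset = (#|` T|%fset * #|` verts S|%fset)%N.
Proof.
rewrite /= card_imfset /=; last exact: coset_point_inj.
by rewrite cardfsM mulnC [X in (X * _)%N]card_imfset //= -cardE -cardfE.
Qed.

Lemma card_lift_edges S :
  #|` edges (lift_subgraph S)|%fset =
  (#|` edges S|%fset + #|` verts S|%fset * #|` trivial_symbols|%fset)%N.
Proof.
rewrite /= card_imfset /=; last exact: coset_edge_inj.
rewrite /lift_indices cardfsU -cardfsM (_ : (_ `&` _)%fset = fset0).
  rewrite cardfs0 subn0 card_imfset //.
  by move=> [a y] [b z] [-> /val_inj ->].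
apply/fsetP => e; rewrite in_fsetI in_fsetM in_fset0; apply/negP.
case/andP=> /imfsetP[[a y] _ ->] /= /andP[_].
by rewrite mem_trivial_symbols; apply/negP/(valP y).
Qed.

Lemma word_val_rcons (w : word X) l :
  wval (rcons w l) = wval w * (if l.2 then (gen P l.1)^-1 else gen P l.1).
Proof. by rewrite /word_val -cats1 big_cat big_seq1. Qed.

(** Over each vertex of [S], the edges with trivial symbol contain a copy of
    the tree formed by the words of [T]: if [t] extends [u] by a letter, then
    the edge of that letter between [u] and [t] has trivial symbol. *)
Lemma lift_schreier_tree S (Q : G -> Prop) a t :
    (forall e : edge (cayley P),
       e \in lift_edges S -> Q (src e) <-> Q (tgt e)) ->
    a \in verts S -> t \in T ->
  Q (val a * wval t) <-> Q (val a).
Proof.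
move=> Qe aS; have [_ _ prefT] := schreierT.
elim/last_ind: t => [_|t l IHt tlT]; first by rewrite /word_val big_nil mulg1.
have tT : t \in T by apply: (prefT _ [:: l]); rewrite cats1.
rewrite -IHt // word_val_rcons; case: l tlT => x b tlT /=.
have := coset_rep_wval tlT; have := coset_rep_wval tT; rewrite word_val_rcons /=.
case: b tlT => tlT /= repT repTl.
  (* The last letter is the inverse of [x], so the edge runs from the longer
     word to the shorter one. *)
  have e1 : elt ([` tlT]%fset, x) = 1.
    by rewrite /schreier_elt /= word_val_rcons /= mulgVK repT mulgV.
  have /Qe : coset_edge (a, ([` tlT]%fset, x)) \in lift_edges S.
    by rewrite mem_coset_edge; apply/lift_indicesP; right.
  by rewrite /= /coset_point /= word_val_rcons /= -!mulgA mulVg mulg1 mulgA.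
have e1 : elt ([` tT]%fset, x) = 1.
  by rewrite /schreier_elt /= repTl word_val_rcons /= mulgV.
have /Qe : coset_edge (a, ([` tT]%fset, x)) \in lift_edges S.
  by rewrite mem_coset_edge; apply/lift_indicesP; right.
by rewrite /= /coset_point /= -mulgA => ->.
Qed.

Lemma lift_connected S :
  connected_subgraph S -> connected_subgraph (lift_subgraph S).
Proof.
move=> connS; apply: connected_intro.
  have [/fset0Pn[a aS] _] := connS; apply/fset0Pn.
  exists (coset_point (a, [` nil_in_transversal]%fset)).
  by rewrite /= mem_coset_point.
move=> Q Qe u v /lift_vertsP[a [t [aS ->]]] /lift_vertsP[b [s [bS ->]]].
rewrite /coset_point /= !(lift_schreier_tree Qe) ?(valP t) ?(valP s) //.
move=> Qa; pose Q1 (c : vertex (cayley P1)) := Q (val (c : G1)).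
suff Q1e e : e \in edges S -> Q1 (src e) <-> Q1 (tgt e).
  exact: (connected_ind (Q := Q1) connS Q1e aS Qa bS).
move: e => [c y] eS; have [cS cyS] := (src_verts eS, tgt_verts eS).
have eL : coset_edge (c, val y) \in lift_edges S.
  by rewrite mem_coset_edge; apply/lift_indicesP; left; exists y.
have := Qe _ eL; rewrite coset_edge_tgt_basis coset_edge_src /coset_point.
rewrite (lift_schreier_tree Qe cS (valP _)).
by rewrite (lift_schreier_tree Qe cyS (coset_rep_in _)).
Qed.

Lemma lift_exhausting_chain (S : nat -> subgraph (cayley P1)) :
  exhausting_chain S -> exhausting_chain (fun i => lift_subgraph (S i)).
Proof.
case=> connS leV leE allV allE; split=> [i|i|i|g|[g x]].
- exact: lift_connected.
- apply/fsubsetP => g /lift_vertsP[a [t [aS ->]]]; apply/lift_vertsP.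
  by exists a, t; split=> //; apply: (fsubsetP (leV i)).
- apply/fsubsetP => _ /imfsetP[[a tx] /= /lift_indicesP aS ->].
  rewrite mem_coset_edge; apply/lift_indicesP; case: aS => [[y yE eS]|[aS e1]].
    by left; exists y => //; apply: (fsubsetP (leE i)).
  by right; split=> //; apply: (fsubsetP (leV i)).
- have [[a t] <-] := coset_point_surj g; have [i aS] := allV a.
  by exists i; rewrite /= mem_coset_point.
- have [[a t] <-] := coset_point_surj g.
  have [e1|e1] := eqVneq (elt (t, x)) 1.
    have [i aS] := allV a; exists i.
    rewrite (mem_coset_edge (S i) (a, (t, x))).
    by apply/lift_indicesP; right.
  have [i eS] := allE (a, exist _ (t, x) e1); exists i.
  rewrite (mem_coset_edge (S i) (a, (t, x))).
  by apply/lift_indicesP; left; exists (exist _ (t, x) e1).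
Qed.

Lemma cyclomatic_number_lift S : connected_subgraph S ->
  (cyclomatic_number (lift_subgraph S) + #|` T|%fset * #|` verts S|%fset =
   cyclomatic_number S + #|` verts S|%fset +
     #|` verts S|%fset * #|` trivial_symbols|%fset)%N.
Proof.
move=> connS; rewrite -card_lift_verts.
rewrite (cyclomatic_number_connected (lift_connected connS)) card_lift_edges.
by rewrite (cyclomatic_number_connected connS) addnAC.
Qed.

Section Quotient.
Variable R : realType.
Local Open Scope ring_scope.

(** For single connected subgraphs, the two sides of the desired inequality are
    equal. *)
Lemma xi_lift S : connected_subgraph S ->
  1 - #|schreier_basis P H T|%:R + xi R S =
  #|` T|%fset%:R * (1 - #|X|%:R + xi R (lift_subgraph S)).
Proof.
move=> connS; have [V0 _] := connS.
have V0R : #|` verts S|%fset%:R != 0 :> R by rewrite pnatr_eq0 cardfs_eq0.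
have T0R : #|` T|%fset%:R != 0 :> R.
  rewrite pnatr_eq0 cardfs_eq0; apply/fset0Pn.
  by exists [::]; exact: nil_in_transversal.
have /(congr1 (@GRing.natmul R 1)) := card_trivial_symbols.
have /(congr1 (@GRing.natmul R 1)) := cyclomatic_number_lift connS.
rewrite /xi card_lift_verts !natrD !natrM.
move=> /(canRL (addrK _)) -> /(canRL (addKr _)) ->.
by field; rewrite V0R.
Qed.

End Quotient.

End SchreierLift.

(** * Upper limits and the inequality *)

Local Open Scope ereal_scope.

Lemma limn_esup_affine_le (R : realType) (m c : R) (u : nat -> R) : (0 < m)%R ->
  limn_esup (fun i => (m * u i + c)%:E) <=
  m%:E * limn_esup (fun i => (u i)%:E) + c%:E.
Proof.
move=> m0; rewrite -leeBlDr // -lee_pdivrMl // /limn_esup !limf_esupE.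
apply: le_ereal_inf_tmp => _ [V nV <-].
rewrite lee_pdivrMl // leeBlDr //.
apply: (@le_trans _ _ (ereal_sup [set (m * u i + c)%:E | i in V]%classic)).
  by apply: ereal_inf_lbound; exists V.
apply: ge_ereal_sup => _ [i iV <-].
rewrite EFinD EFinM leeD2r // lee_pmul2l // ?lte_fin //.
by apply: ereal_sup_ubound; exists i.
Qed.

Theorem proposition3p4 (R : realType) (G : groupType) (X : finType)
    (P : presentation G X) (H : {pred G}) (G1 : subGroupType H)
    (finite_index : finite_set (right_cosets H))
    (T : {fset word X}) (schreierT : schreier_transversal P H T)
    (P1 : presentation G1 (schreier_basis P H T))
    (schreierP1 : is_schreier_presentation P1) :
  (normalized_cyclomatic_quotient R P1 <=
     (subgroup_index H)%:R%:E * normalized_cyclomatic_quotient R P)%E.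
Proof.
rewrite (subgroup_index_transversal schreierT) /normalized_cyclomatic_quotient.
have m0 : (0 < #|` T|%fset%:R :> R)%R.
  rewrite ltr0n cardfs_gt0; apply/fset0Pn.
  by exists [::]; exact: nil_in_transversal schreierT.
rewrite muleDr // -leeBrDl //.
apply: ge_ereal_sup => _ [S chainS <-].
have chainL := lift_exhausting_chain schreierT schreierP1 chainS.
have [connS _ _ _ _] := chainS.
pose L i := lift_subgraph schreierT schreierP1 (S i).
have xiE i : (xi R (S i) = #|` T|%fset%:R * xi R (L i) +
    (#|` T|%fset%:R * (1 - #|X|%:R) - (1 - #|schreier_basis P H T|%:R)))%R.
  have /(canRL (addKr _)) -> := xi_lift schreierT schreierP1 R (connS i).
  by ring.
under eq_fun do rewrite xiE.
apply: le_trans (limn_esup_affine_le _ _ m0) _.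
rewrite leeBrDl // addeCA -EFinD subrKC addeC EFinM leeD2l //.
rewrite lee_pmul2l // ?lte_fin //.
by apply: ereal_sup_ubound; exists L.
Qed.
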